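(* Let $(\mathbf M,T,\mathcal B,\mu)$ and the generating partition $\mathcal A$ be as in the context. Assume that $T:\mathbf M\to\mathbf M$ preserves the probability measure $\mu$, that $\mu$ is right $\phi$-mixing with respect to $\mathcal A$ with $\phi(k)\le Ck^{-p}$ for some $C>0$ and $p>1$, and that $\{U_n\}$ is a good neighborhood system, with $\Lambda=\bigcap_n U_n$, such that the numbers $\{\hat\alpha_\ell\}_{\ell\ge1}$ exist and satisfy $\sum_{\ell}\ell\,\hat\alpha_\ell<\infty$. Then $$\alpha_1=\lim_{K\to\infty}\lim_{n\to\infty}\mu_{U_n}(\tau_{U_n}>K)$$ exists, and the localized escape rate at $\Lambda$ exists and satisfies $$\rho(\Lambda,\{U_n\})=\alpha_1 .$$
   Context: Setting: $\mathbf M$ is a compact metric space, $\mathcal B$ its Borel $\sigma$-algebra, $T:\mathbf M\to\mathbf M$ a measurable map (not assumed invertible), $\mu$ a $T$-invariant probability measure, also written $\mathbb P$. $\mathcal A$ is a finite or countable measurable partition of $\mathbf M$, $\mathcal A^n=\bigvee_{j=0}^{n-1}T^{-j}\mathcal A$; elements of $\mathcal A^n$ are called $n$-cylinders, $A_n(x)$ is the $n$-cylinder containing $x$, and $\mathcal A$ is generating: $\bigcap_n A_n(x)=\{x\}$. $\sigma(\mathcal A^n)$ is the $\sigma$-algebra generated by the $n$-cylinders. Right $\phi$-mixing: $|\mu(A\cap T^{-n-k}B)-\mu(A)\mu(B)|\le\phi(k)\mu(B)$ for all $n\in\mathbb N$, $A\in\sigma(\mathcal A^n)$ and $B\in\sigma(\bigcup_j\mathcal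 A^j)$, where $\phi(k)$ decreases to $0$ as $k\to\infty$. Entry times: $\tau_U(x)=\min\{j\ge1:T^j(x)\in U\}$ ($=\infty$ if there is no such $j$); $\tau_U^1=\tau_U$, $\tau_U^j(x)=\tau_U^{j-1}(x)+\tau_U(T^{\tau_U^{j-1}(x)}(x))$, and $\tau_U^0=0$ on $U$. $\mu_U(\cdot)=\mu(\cdot\cap U)/\mu(U)$. Nested sequence: sets $U_n$ of positive measure with $U_{n+1}\subset U_n$ and $\mu(U_n)\to0$. Escape rate: $\rho(U)=\lim_{t\to\infty}\frac1t|\log\mathbb P(\tau_U>t)|$. Localized escape rate at $\Lambda=\bigcap_nU_n$: $\rho(\Lambda,\{U_n\})=\lim_{n\to\infty}\rho(U_n)/\mu(U_n)$. Good neighborhood system: a nested sequence $\{U_n\}$ such that each $U_n$ is a union of $\kappa_n$-cylinders for a non-decreasing sequence of integers $\kappa_n$, and (1) $\kappa_n\nearrow\infty$ and $\kappa_n\mu(U_n)^\varepsilon\to0$ for some $\varepsilon\in(0,1)$; (2) there exist $C>0$ and $p'>1$ with $\mu(U_n^j)\le\mu(U_n)+Cj^{-p'}$ for all $j<\kappa_n$, where $U_n^j=\bigcup\{A\in\mathcal A^j:A\cap U_n\neq\emptyset\}$. The numbers $\hat\alpha_\ell$: $\hat\alpha_\ell(K,U_n)=\mu_{U_n}(\tau_{U_n}^{\ell-1}\le K)$, $\hat\alpha_\ell(K)=\lim_{n\to\infty}\hat\alpha_\ell(K,U_n)$, $\hat\alpha_\ell=\lim_{K\to\infty}\hat\alpha_\ell(K)$.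 ''$\{\hat\alpha_\ell\}$ exists'' means that the limit $\hat\alpha_\ell(K)$ exists for all $K\in\mathbb N$ large enough and every $\ell\ge1$ (then $\hat\alpha_\ell$ exists by monotonicity in $K$, and $\hat\alpha_1=1$).
   Formalization: The escape rate ρ(U_n) of a single U_n need not exist under these hypotheses, so the limit ρ(U_n)/μ(U_n)→α_1 is proved with both the lower and the upper limit in t in place of the limit; where the ρ(U_n) exist for large n, it is the stated equality. *)

(* Defs.v *)
From HB Require Import structures.
From mathcomp Require Import all_boot all_order all_algebra.
From mathcomp Require Import all_classical all_reals all_analysis.

Set Implicit Arguments.
Unset Strict Implicit.
Unset Printing Implicit Defensive.

Import Order.TTheory GRing.Theory Num.Theory.
Import numFieldNormedType.Exports.

Local Open Scope classical_set_scope.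
Local Open Scope ring_scope.

(* [measurableType] is pointed, so the Borel sigma-algebra of a metric space is
   only available on a pointed one; a space that carries a probability measure
   is nonempty, so this is no restriction. *)
#[short(type="pmetricType")]
HB.structure Definition PMetric (K : numDomainType) :=
  { M of Metric K M & isPointed M }.

Notation borel M := (g_sigma_algebraType (@open M)).

Section EntryTimes.
Context {X : Type}.
Implicit Types (T : X -> X) (U : set X) (x : X).

(* [None] encodes an infinite entry time. *)
Definition entry_time T U x : option nat :=
  if pselect (exists j, (0 < j)%N && `[< U (iter j T x) >]) is left e
  then Some (ex_minn e) else None.

(* The value 0 at order 0 is only meant for points of [U]. *)
Fixpoint entry_time_iter T U (l : nat) x : option nat :=
  if l is m.+1 then
    if entry_time_iter T U m x is Some s
    then omap (addn s) (entry_time T U (iter s T x)) else None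
  else Some 0%N.

Definition time_le (t : option nat) (K : nat) : bool :=
  if t is Some j then (j <= K)%N else false.

Definition time_gt (t : option nat) (K : nat) : bool := ~~ time_le t K.

End EntryTimes.

Section Cylinders.
Context {X : Type}.
Variables (T : X -> X) (P : set (set X)).

(* The nonempty elements of the join of the T^{-j} P, j < n; for n = 0 this is
   the trivial partition. *)
Definition cylinder (n : nat) : set (set X) :=
  [set D | D !=set0 /\ exists a : nat -> set X,
     (forall j, (j < n)%N -> P (a j)) /\
     D = [set x | forall j, (j < n)%N -> a j (iter j T x)]].

Definition cylinder_at (n : nat) (x : X) : set X :=
  [set y | exists2 D, cylinder n D & D x /\ D y].

Definition generating := forall x, \bigcap_n cylinder_at n x = [set x].

Definition cylinder_hull (j : nat) (U : set X) : set X :=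
  \bigcup_(D in [set D | cylinder j D /\ D `&` U !=set0]) D.

End Cylinders.

Section Systems.
Context {d : measure_display} {X : measurableType d} {R : realType}.
Variables (mu : probability X R) (T : X -> X) (P : set (set X)).
Implicit Types (U : nat -> set X) (V : set X).

Definition measurable_partition :=
  [/\ countable P, forall D, P D -> measurable D & partition P id [set: X]].

Definition measure_preserving :=
  measurable_fun [set: X] T /\
  forall B, measurable B -> mu (T @^-1` B) = mu B.

Definition right_phi_mixing (phi : nat -> R) :=
  [/\ nonincreasing_seq phi, phi n @[n --> \oo] --> (0 : R) &
   forall (n k : nat) (A B : set X),
     <<s cylinder T P n >> A -> <<s \bigcup_j cylinder T P j >> B ->
     (`|mu (A `&` iter (n + k) T @^-1` B) - mu A * mu B|
       <= (phi k)%:E * mu B)%E].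

Definition nested_sequence U :=
  [/\ forall n, measurable (U n), forall n, (0 < mu (U n))%E,
      forall n, U n.+1 `<=` U n & mu (U n) @[n --> \oo] --> 0%E].

Definition good_neighborhood_system U :=
  nested_sequence U /\
  exists kappa : nat -> nat,
  [/\ nondecreasing_seq kappa,
      forall n, exists2 F, F `<=` cylinder T P (kappa n) &
                           U n = \bigcup_(D in F) D,
      kappa n @[n --> \oo] --> \oo,
      exists eps : R, 0 < eps < 1 /\
        (kappa n)%:R * fine (mu (U n)) `^ eps @[n --> \oo] --> (0 : R) &
      exists C p' : R, [/\ 0 < C, 1 < p' &
        forall n j, (0 < j < kappa n)%N ->
          (mu (cylinder_hull T P j (U n))
            <= mu (U n) + (C * j%:R `^ (- p'))%:E)%E]].

Definition cond_prob V (E : set X) : R := fine (mu (E `&` V)) / fine (mu V).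

Definition hat_alpha_set (l K : nat) V : R :=
  cond_prob V [set x | time_le (entry_time_iter T V l.-1 x) K].

Definition hat_alpha_upto U (l K : nat) : R :=
  limn (fun n => hat_alpha_set l K (U n)).

Definition hat_alpha U (l : nat) : R := limn (fun K => hat_alpha_upto U l K).

Definition hat_alpha_exists U :=
  exists K0 : nat, forall K l : nat, (K0 <= K)%N -> (1 <= l)%N ->
    cvgn (fun n => hat_alpha_set l K (U n)).

(* (1/t) |log P(tau_V > t)|, with |log 0| = +oo. *)
Definition decay_rate V (t : nat) : \bar R :=
  ((t%:R^-1)%:E * `|lne (mu [set x | time_gt (entry_time T V x) t])|)%E.

Definition is_escape_rate V (r : \bar R) := decay_rate V t @[t --> \oo] --> r.

Definition lower_escape_rate V : \bar R := limn_einf (decay_rate V).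
Definition upper_escape_rate V : \bar R := limn_esup (decay_rate V).

(* Polynomial phi-mixing does not guarantee that the limit defining the escape
   rate of an individual [U n] exists (renewal processes whose hazard rate
   oscillates on longer and longer blocks are counterexamples).  The double
   limit is therefore taken, as is usual for iterated limits, with the lower
   and with the upper limit in t, both having to give [l]; the last clause is
   the case where the escape rates themselves exist. *)
Definition is_localized_escape_rate U (l : \bar R) :=
  [/\ (lower_escape_rate (U n) / mu (U n))%E @[n --> \oo] --> l,
      (upper_escape_rate (U n) / mu (U n))%E @[n --> \oo] --> l &
      forall rho : nat -> \bar R,
        (\forall n \near \oo, is_escape_rate (U n) (rho n)) ->
        (rho n / mu (U n))%E @[n --> \oo] --> l].

Definition is_alpha1 U (a : R) :=
  exists aK : nat -> R,
    (\forall K \near \oo,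
       cond_prob (U n) [set x | time_gt (entry_time T (U n) x) K]
         @[n --> \oo] --> aK K) /\
    aK K @[K --> \oo] --> a.

End Systems.

(* Main.v *)
Require Import Defs.
From HB Require Import structures.
From mathcomp Require Import all_boot all_order all_algebra.
From mathcomp Require Import all_classical all_reals all_analysis.
From mathcomp Require Import ring lra zify.

Set Implicit Arguments.
Unset Strict Implicit.
Unset Printing Implicit Defensive.

Import Order.TTheory GRing.Theory Num.Theory.
Import numFieldNormedType.Exports.

Local Open Scope classical_set_scope.
Local Open Scope ring_scope.

(**
   Write [v t] for the probability that an orbit avoids [U n] during [t]
   consecutive steps; by invariance it is also the probability that the entry
   time exceeds [t]. The proof estimates [v] on blocks of a length [s] chosen
   with
     [kappa n << s << mu (U n)^-1]  and  [phi (kappa n) << s * mu (U n)]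
   ([ex_block_lengths]).

   Probability of a hit during one block. Sorting the points by their last
   visit, [1 - v s] is the sum over [j < s] of the measure of the points of [U n]
   that do not return within [j] steps ([pr_hitE]). A first return between times
   [K] and [s] is unlikely, uniformly in [n]: a return at time [i] is controlled
   by mixing, after [U n] is replaced by the union of the cylinders of order
   [i / 2] that meet it if [i / 2 < kappa n] ([pr_return_le]); the
   resulting bounds are summable since both exponents exceed 1. Hence the terms
   of the sum are nearly constant, and [(1 - v s) / (s * mu (U n))] tends to
   [alpha1] ([cvg_hit]).

   From one block to the rate of decay. The mixing error is proportional to the
   measure of the event in the future, so it stays multiplicative when blocks
   are chained. With a gap [g := kappa n + kappa n] between blocks this gives
     [v (s + g + t) <= (v s + phi (kappa n)) * v t]  ([avoid_le_mul]),
     [v (s + t) >= v t - (1 - v s + phi (kappa n)) * v (t - g)]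
   ([avoid_ge_sub]). The first is iterated directly. The second is a two-step
   linear recurrence with a small coefficient [q := 1 - v s + phi (kappa n)]; it
   keeps the ratio of consecutive terms above [1 - r] for some [r] equivalent to
   [q]. Therefore all the limit points of [t^-1 * |ln (v t)|] lie between
   [(1 - v s - phi (kappa n)) / (s + g)] and [q / ((1 - 3 * q) * s)]. After
   division by [mu (U n)] both bounds tend to [alpha1], whether or not the escape
   rate of [U n] exists.

   Finally [alpha1] exists because the probability of no return within [K] steps
   is one minus the quantity whose limits define [hat_alpha U 2], and it is
   monotone in [K].
*)

(** * Lower and upper limits of extended real sequences *)

Section ExtendedReals.
Context {R : realType}.

(** Rates measured on whole blocks bound the decay rate at a time [t] up to an
    error of order [t^-1]; the convergent sequence [w] accounts for it. *)
Lemma limn_einf_ge (u : (\bar R)^nat) (w : R^nat) (l : R) :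
  (\forall t \near \oo, ((w t)%:E <= u t)%E) -> w t @[t --> \oo] --> l ->
  (l%:E <= limn_einf u)%E.
Proof.
move=> wu wl; rewrite /limn_einf leeNr /limn_esup.
apply/lee_addgt0Pr => e e0.
have [N _ Nu] : \forall t \near \oo, ((\- u)%E t <= (- l%:E + e%:E))%E.
  near=> t; rewrite leeNl oppeD// oppeK -EFinB.
  apply: (@le_trans _ _ (w t)%:E); last by near: t.
  rewrite lee_fin.
  have : `|l - w t| < e by near: t; exact: cvgr_dist_lt.
  by rewrite ltr_norml => /andP[_]; lra.
apply: ge_ereal_inf; exists (ereal_sup ((\- u)%E @` [set t | (N <= t)%N])).
  by exists [set t | (N <= t)%N] => //; exists N.
by apply: ge_ereal_sup => _ [t Nt <-]; exact: Nu.
Unshelve. all: by end_near. Qed.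

Lemma limn_esup_le (u : (\bar R)^nat) (w : R^nat) (l : R) :
  (\forall t \near \oo, (u t <= (w t)%:E)%E) -> w t @[t --> \oo] --> l ->
  (limn_esup u <= l%:E)%E.
Proof.
move=> uw wl; rewrite -leeN2 -limn_einfN -EFinN.
apply: (@limn_einf_ge _ (fun t => - w t)); last exact: cvgN.
by near=> t; rewrite /= EFinN leeN2; near: t.
Unshelve. all: by end_near. Qed.

Lemma abs_lne_ge (a c : R) : 0 <= a -> a <= expR (- c) ->
  (c%:E <= `|lne a%:E|)%E.
Proof.
rewrite le_eqVlt => /orP[/eqP<-|a0] ac; first by rewrite /= lexx leey.
rewrite lne_EFin//= lee_fin -normrN (le_trans _ (ler_norm _))//.
by rewrite lerNr -[leRHS]expRK ler_ln ?posrE ?expR_gt0.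
Qed.

Lemma abs_lne_le (a c : R) : a <= 1 -> expR (- c) <= a ->
  (`|lne a%:E| <= c%:E)%E.
Proof.
move=> a1 ca; have a0 : 0 < a := lt_le_trans (expR_gt0 _) ca.
rewrite lne_EFin//= lee_fin ler0_norm ?ln_le0//.
by rewrite lerNl -[leLHS]expRK ler_ln ?posrE ?expR_gt0.
Qed.

Lemma cvg_invn : (t%:R^-1 : R) @[t --> \oo] --> (0 : R).
Proof.
apply/gtr0_cvgV0; last exact: cvgr_idn.
by near=> t; rewrite ltr0n; near: t; exact: nbhs_infty_gt.
Unshelve. all: by end_near. Qed.

End ExtendedReals.

(** * Sums, averages and block lengths *)

Section RealEstimates.
Context {R : realType}.
Implicit Types (p : R).

(** Comparison with the integral of [x `^ (- p)] over [[j, j + 1]]. With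
    [y := j + 1], the ratio of [j `^ (1 - p)] to [y `^ (1 - p)] is
    [expR ((p - 1) * (ln y - ln j))], which [ln (1 + t) <= t] and
    [1 + t <= expR t] bound below by [1 + (p - 1) / y]. *)
Lemma powRN_le_telescope p (j : nat) : 1 < p -> (0 < j)%N ->
  j.+1%:R `^ (- p) <= (j%:R `^ (1 - p) - j.+1%:R `^ (1 - p)) / (p - 1).
Proof.
move=> p1 j0; set x : R := j%:R; set y : R := j.+1%:R.
have x0 : 0 < x by rewrite ltr0n.
have y0 : 0 < y by rewrite ltr0n.
have yx : y = x + 1 by rewrite /y -natr1.
have lnxy : y^-1 <= ln y - ln x.
  rewrite -lerN2 opprB -ln_div ?posrE//.
  have -> : x / y = 1 + (- y^-1) by rewrite yx; field; rewrite -yx gt_eqF.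
  by apply: le_ln1Dx; rewrite ltrN2 invf_lt1// /y ltr1n.
have -> : x `^ (1 - p) = y `^ (1 - p) * expR ((p - 1) * (ln y - ln x)).
  rewrite /powR !gt_eqF// -expRD; congr expR; ring.
have yp : y `^ (- p) = y `^ (1 - p) * y^-1.
  have e : - p = (1 - p) - 1 by ring.
  rewrite [in LHS]e powRB ?powRr1 ?(ltW y0)//.
  by rewrite (gt_eqF y0) implybT.
rewrite ler_pdivlMr ?subr_gt0// yp -[X in _ <= _ - X]mulr1 -mulrBr -mulrA.
rewrite ler_wpM2l ?powR_ge0// lerBrDl.
apply: le_trans (expR_ge1Dx _); rewrite lerD2l mulrC.
by rewrite ler_wpM2l// subr_ge0 ltW.
Qed.

Lemma sum_powRN_le p (K s : nat) : 1 < p -> (0 < K)%N -> (K <= s)%N ->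
  \sum_(K <= j < s) j.+1%:R `^ (- p) <= K%:R `^ (1 - p) / (p - 1).
Proof.
move=> p1 K0 Ks; have p0 : 0 < p - 1 by rewrite subr_gt0.
apply: (@le_trans _ _ ((K%:R `^ (1 - p) - s%:R `^ (1 - p)) / (p - 1))); last first.
  by rewrite ler_pM2r ?invr_gt0// gerBl powR_ge0.
rewrite -(opprB (s%:R `^ _)) -(telescope_sumr (fun j : nat => j%:R `^ (1 - p)) Ks).
rewrite -sumrN mulr_suml ler_sum_nat// => j /andP[Kj _].
by rewrite opprB powRN_le_telescope// (leq_trans K0).
Qed.

(** Return times are cut in halves below, so the tail of the series is needed
    along [j.+1./2]; this costs the factor [4 `^ p] because
    [j.+1 <= 4 * j.+1./2] for [j] positive. *)
Lemma sum_half_powRN_le p (K s : nat) : 1 < p -> (0 < K)%N -> (K <= s)%N ->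
  \sum_(K <= j < s) (j.+1./2)%:R `^ (- p)
    <= 4 `^ p * (K%:R `^ (1 - p) / (p - 1)).
Proof.
move=> p1 K0 Ks; apply: le_trans (ler_wpM2l (powR_ge0 _ _) (sum_powRN_le p1 K0 Ks)).
rewrite mulr_sumr ler_sum_nat// => j /andP[Kj _].
have j0 : 0 < (j.+1)%:R :> R by rewrite ltr0n.
have h0 : 0 < (j.+1./2)%:R :> R by rewrite ltr0n half_gt0; lia.
rewrite !powRN ler_pdivlMr ?powR_gt0// ler_pdivrMl ?powR_gt0//.
rewrite -powRM ?(ltW h0)//; apply: ge0_ler_powR; rewrite ?nnegrE ?(ltW j0)//.
- by lra.
rewrite -natrM ler_nat; have := odd_double_half j.+1; lia.
Qed.

Lemma cvg_powRN_natr p : 1 < p -> (K%:R `^ (1 - p)) @[K --> \oo] --> (0 : R).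
Proof.
move=> p1; have p0 : 0 < p - 1 by rewrite subr_gt0.
have -> : (fun K : nat => K%:R `^ (1 - p) : R) =
          (fun K : nat => (K%:R^-1) `^ (p - 1)).
  apply/funext => K; have -> : 1 - p = - (p - 1) by ring.
  by rewrite powRN -[in RHS]powR_inv1// -powRrM mulN1r powRN.
move=> A /(powR_cvg0 p0)/cvg_invn near_A.
change (\forall K \near \oo, A ((K%:R^-1) `^ (p - 1))); near=> K.
have : 0 < (K%:R^-1 : R) by rewrite invr_gt0 ltr0n; near: K; exact: nbhs_infty_gt.
by near: K; apply: near_A.
Unshelve. all: by end_near. Qed.

(** The first [K] terms are at most [1] and all later ones at most [b K]. *)
Lemma cesaro_le (b : nat -> R) (K s : nat) :
  {homo b : i j / (i <= j)%N >-> j <= i} -> (forall j, b j <= 1) ->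
  0 <= b K ->
  \sum_(j < s) b j <= K%:R + s%:R * b K.
Proof.
move=> bdec b1 bK.
have : \sum_(j < s) b j <= (minn s K)%:R + s%:R * b K.
  elim: s => [|s IHs]; first by rewrite big_ord0 min0n mul0r addr0.
  rewrite big_ord_recr /= -natr1 mulrDl mul1r addrA.
  have [sK|Ks] := ltnP s K.
    rewrite (minn_idPl sK) -natr1; move: IHs; rewrite (minn_idPl (ltnW sK)).
    by have := b1 s; lra.
  rewrite (minn_idPr (leqW Ks)); move: IHs; rewrite (minn_idPr Ks).
  by have := bdec _ _ Ks; lra.
move=> /le_trans; apply; rewrite lerD2r ler_nat; lia.
Qed.

Lemma cesaro_ge (b : nat -> R) (s : nat) :
  {homo b : i j / (i <= j)%N >-> j <= i} -> s%:R * b s <= \sum_(j < s) b j.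
Proof.
move=> bdec; rewrite mulr_natl -[leLHS](_ : \sum_(j < s) b s = _).
  by apply: ler_sum => j _; apply: bdec; exact: ltnW.
by rewrite sumr_const card_ord.
Qed.

(** Between the times [K] and [s n] the nonincreasing sequence [b n] loses at
    most [z n + e K], hence it is nearly constant there and its average over
    [s n] terms is nearly [b n K], up to [K / s n] for the initial terms. Letting
    first [n] and then [K] go to infinity gives the iterated limit. *)
Lemma cvg_cesaro_diagonal (b : nat -> nat -> R) (s : nat -> nat)
    (z e aK : nat -> R) (a : R) :
  (forall n, {homo b n : i j / (i <= j)%N >-> j <= i}) ->
  (forall n j, 0 <= b n j <= 1) ->
  (\forall K \near \oo, \forall n \near \oo, b n K - z n - e K <= b n (s n)) ->
  s n @[n --> \oo] --> \oo -> z n @[n --> \oo] --> 0 -> e K @[K --> \oo] --> 0 ->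
  (\forall K \near \oo, b n K @[n --> \oo] --> aK K) -> aK K @[K --> \oo] --> a ->
  ((s n)%:R^-1 * \sum_(j < s n) b n j) @[n --> \oo] --> a.
Proof.
move=> bdec b01 bs sy z0 e0 baK aKa; apply/cvgrPdist_lt => eps eps0.
have eps4 : 0 < eps / 4 by rewrite divr_gt0.
have : \forall K \near \oo, [/\ b n K @[n --> \oo] --> aK K,
    \forall n \near \oo, b n K - z n - e K <= b n (s n),
    `|a - aK K| < eps / 4 & `|0 - e K| < eps / 4].
  by near=> K; split; near: K => //; [exact: cvgr_dist_lt|exact: cvgr_dist_lt].
move=> [K _ /(_ K (leqnn K))[baKK bsK aKK eK]].
near=> n.
have sn0 : 0 < (s n)%:R :> R.
  by rewrite ltr0n; near: n; move/cvgnyPge: sy => /(_ 1%N).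
have Ks : K%:R / (s n)%:R < eps / 4.
  rewrite ltr_pdivrMr// mulrC -ltr_pdivrMr//; near: n.
  by move: (K%:R / _); apply/cvgryPgt; exact/cvgrnyP.
have bn : `|aK K - b n K| < eps / 4 by near: n; exact: cvgr_dist_lt.
have zn : `|0 - z n| < eps / 4 by near: n; exact: cvgr_dist_lt.
have bsn : b n K - z n - e K <= b n (s n) by near: n.
have up : (s n)%:R^-1 * \sum_(j < s n) b n j <= K%:R / (s n)%:R + b n K.
  rewrite ler_pdivrMl// mulrDr mulrCA divff ?gt_eqF// mulr1.
  apply: cesaro_le => //; first by move=> j; case/andP: (b01 n j).
  by case/andP: (b01 n K).
have lo : b n (s n) <= (s n)%:R^-1 * \sum_(j < s n) b n j.
  by rewrite ler_pdivlMl// cesaro_ge.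
move: aKK eK bn zn; rewrite !ltr_norml sub0r => /andP[? ?] /andP[? ?] /andP[? ?].
by rewrite sub0r => /andP[? ?]; apply/andP; split; lra.
Unshelve. all: by end_near. Qed.

(** A block length [s] that is much shorter than [mu^-1], so that a block is
    seldom hit, but much longer than [kappa] and than [f / mu], so that the gap
    between blocks and the mixing error are negligible in comparison with the
    probability [s * mu] of a hit. The square root makes [delta] large with
    respect to both [kappa * mu] and [f], and then [s] of order [delta / mu]
    has all these properties. *)
Lemma block_length_exists (mu f : R) (kappa : nat) :
  let delta := Num.sqrt (kappa%:R * mu + f) in
  0 < mu -> 0 <= f -> (0 < kappa)%N -> delta <= 4^-1 ->
  exists s : nat, [/\ s%:R * mu <= delta, kappa%:R <= 2 * delta * s%:R &
                      f <= 2 * delta * (s%:R * mu)].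
Proof.
move=> delta mu0 f0 kappa0 delta4.
have k1 : 1 <= kappa%:R :> R by rewrite ler1n.
have km0 : 0 < kappa%:R * mu by rewrite mulr_gt0// ltr0n.
have d0 : 0 < delta by rewrite sqrtr_gt0; lra.
have d2 : delta * delta = kappa%:R * mu + f.
  by rewrite -expr2 sqr_sqrtr//; lra.
have dm0 : 0 <= delta / mu by rewrite divr_ge0 ?ltW.
have /andP[sle slt] := truncn_itv dm0.
exists (Num.truncn (delta / mu)); move: sle slt.
set s := Num.truncn _; rewrite ler_pdivlMr// => sle.
rewrite ltr_pdivrMr// -natr1 => slt.
split => //.
- rewrite -(ler_pM2r mu0) -mulrA; nra.
- nra.
Qed.

End RealEstimates.

(** * Avoidance of a set and itineraries *)

Section Avoidance.
Context {X : Type}.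
Implicit Types (T : X -> X) (V : set X).

(** The points whose orbit stays outside [V] at the times [0], ..., [t - 1]. An
    entry time larger than [t] concerns the times [1], ..., [t] instead; by
    invariance both events have the same measure, and starting at time [0] makes
    consecutive blocks fit together. *)
Definition avoid T V t : set X := [set x | forall j, (j < t)%N -> ~ V (iter j T x)].

Lemma avoid0 T V : avoid T V 0 = setT.
Proof. by apply/seteqP; split => // x _ j. Qed.

Lemma avoidD T V s t :
  avoid T V (s + t) = avoid T V s `&` iter s T @^-1` avoid T V t.
Proof.
apply/seteqP; split => x /=.
  move=> h; split => j jt; first by apply: h; lia.
  by rewrite -iterD; apply: h; lia.
move=> [h1 h2] j jst; have [js|sj] := ltnP j s; first exact: h1.
rewrite -(subnK sj) iterD; apply: h2; lia.
Qed.

Lemma avoid1 T V : avoid T V 1 = ~` V.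
Proof.
by apply/seteqP; split => x /= h; [exact: (h 0%N)|case].
Qed.

Lemma avoidS T V t : avoid T V t.+1 = ~` V `&` T @^-1` avoid T V t.
Proof. by rewrite -add1n avoidD avoid1. Qed.

Lemma subset_avoid T V s t : (s <= t)%N -> avoid T V t `<=` avoid T V s.
Proof. by move=> st x h j js; apply: h; exact: leq_trans st. Qed.

Lemma entry_time_gtE T V t :
  [set x | time_gt (entry_time T V x) t] = T @^-1` avoid T V t.
Proof.
apply/seteqP; split => x /=; rewrite /time_gt /time_le /entry_time.
  case: pselect => [e|ne] h j jt VTj.
    case: ex_minnP h => m _ mmin /negP; apply.
    apply: leq_trans jt; apply: mmin; apply/andP; split => //.
    by apply/asboolP; rewrite iterSr.
  apply: ne; exists j.+1; apply/andP; split => //.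
  by apply/asboolP; rewrite iterSr.
case: pselect => // e h; case: ex_minnP => m /andP[m0 /asboolP VTm] _.
apply/negP => mt; case: m m0 mt VTm => // m _ mt.
by rewrite iterSr; apply: h.
Qed.

End Avoidance.

Section Itineraries.
Context {X : Type}.
Variables (T : X -> X) (P : set (set X)).

(** Belonging to a common [n]-cylinder, phrased without choosing a cylinder. *)
Definition same_itinerary n x y :=
  forall j D, (j < n)%N -> P D -> D (iter j T x) <-> D (iter j T y).

(** The events that depend on the first [n] letters of the itinerary only. For a
    partition they are exactly the unions of [n]-cylinders, and in this form
    their stability under complement and preimage is immediate. *)
Definition saturated n (A : set X) :=
  forall x y, same_itinerary n x y -> A x -> A y.

Lemma same_itinerary_sym n x y : same_itinerary n x y -> same_itinerary n y x.
Proof. by move=> xy j D jn PD; apply: iff_sym; exact: xy. Qed.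

Lemma saturatedC n A : saturated n A -> saturated n (~` A).
Proof.
by move=> An x y xy nAx Ay; apply: nAx; apply: An (same_itinerary_sym xy) Ay.
Qed.

Lemma saturated_preimage j n A :
  saturated n A -> saturated (j + n) (iter j T @^-1` A).
Proof.
move=> An x y xy; apply: An => i D ni PD; rewrite -!iterD.
by apply: xy => //; lia.
Qed.

Lemma saturated_avoid n V t : saturated n V -> saturated (t + n) (avoid T V t).
Proof.
move=> Vn x y xy h j jt Vy; apply: (h _ jt).
apply: (saturated_preimage (j := j) Vn) Vy.
by move=> i D ijn PD; apply: iff_sym; apply: xy => //; lia.
Qed.

Hypothesis partP : partition P id [set: X].

Lemma partition_cover x : exists2 D, P D & D x.
Proof.
by case: partP => PT _ _; have : [set: X] x by []; rewrite -PT => -[D PD Dx]; exists D.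
Qed.

Lemma partition_inj D E x : P D -> P E -> D x -> E x -> D = E.
Proof.
case: partP => _ /trivIsetP tr _ PD PE Dx Ex; apply: contrapT.
by move=> /eqP/(tr _ _ PD PE); apply/eqP/set0P; exists x.
Qed.

Lemma cylinder_exists n x : exists2 D, cylinder T P n D & D x.
Proof.
have /choice[a aP] : forall j, exists D, P D /\ D (iter j T x).
  by move=> j; have [D PD Dx] := partition_cover (iter j T x); exists D.
have Dx : [set y | forall j, (j < n)%N -> a j (iter j T y)] x.
  by move=> j _; case: (aP j).
exists [set y | forall j, (j < n)%N -> a j (iter j T y)] => //.
split; first by exists x.
by exists a; split => // j _; case: (aP j).
Qed.

Lemma cylinder_same_itinerary n D x y :
  cylinder T P n D -> D x -> D y -> same_itinerary n x y.
Proof.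
move=> [_ [a [Pa ->]]] ax ay j E jn PE; split => Ez.
  by rewrite (partition_inj PE (Pa _ jn) Ez (ax _ jn)); exact: ay.
by rewrite (partition_inj PE (Pa _ jn) Ez (ay _ jn)); exact: ax.
Qed.

Lemma saturated_cylinder n D : cylinder T P n D -> saturated n D.
Proof.
by move=> [_ [a [Pa ->]]] x y xy ax j jn; apply/(xy _ _ jn (Pa _ jn)); exact: ax.
Qed.

Lemma saturated_bigcup_cylinder n F :
  F `<=` cylinder T P n -> saturated n (\bigcup_(D in F) D).
Proof.
by move=> Fn x y xy [D FD Dx]; exists D => //;
  exact: saturated_cylinder (Fn _ FD) _ _ xy Dx.
Qed.

(** Two points of one cylinder have the same itinerary, so a saturated set
    contains every cylinder that it meets. As there are countably many cylinders,
    this places saturated sets in the generated sigma-algebra. *)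
Lemma cylinder_hullE n A : saturated n A -> cylinder_hull T P n A = A.
Proof.
move=> An; apply/seteqP; split => x.
  move=> [D [nD [y [Dy Ay]]] Dx]; apply: An Ay.
  exact: cylinder_same_itinerary nD Dy Dx.
move=> Ax; have [D nD Dx] := cylinder_exists n x.
by exists D => //; split => //; exists x.
Qed.

Lemma subset_cylinder_hull n A : A `<=` cylinder_hull T P n A.
Proof.
move=> x Ax; have [D nD Dx] := cylinder_exists n x.
by exists D => //; split => //; exists x.
Qed.

(** Appending a letter writes each cylinder of order [n + 1] as the intersection
    of one of order [n] with an iterated preimage of an atom. *)
Lemma countable_cylinder n : countable P -> countable (cylinder T P n).
Proof.
move=> cP; elim: n => [|n IHn].
  apply: (@sub_countable _ _ _ [set [set: X]]); last exact: countable1.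
  apply: subset_card_le => D [_ [a [_ ->]]].
  by apply/seteqP; split.
apply: (@sub_countable _ _ _
    ((fun DE : set X * set X => DE.1 `&` iter n T @^-1` DE.2) @`
      (cylinder T P n `*` P))); last first.
  by apply: (sub_countable (card_image_le _ _)); exact: countableX.
apply: subset_card_le => D [[x Dx] [a [Pa DE]]].
have := Dx; rewrite DE => ax.
exists ([set x | forall j, (j < n)%N -> a j (iter j T x)], a n) => /=.
  split; last exact: Pa.
  split; first by exists x => j jn; apply: ax; lia.
  by exists a; split => // j jn; apply: Pa; lia.
apply/seteqP; split => y /= h.
  move=> j; rewrite ltnS leq_eqVlt => /orP[/eqP->|]; first by case: h.
  by case: h => h _; exact: h.
by split => [j jn|]; apply: h; lia.
Qed.

Lemma sigma_algebra_countable_bigcup (G Q : set (set X)) :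
  countable Q -> Q `<=` G -> <<s G >> (\bigcup_(D in Q) D).
Proof.
move=> /countable_injP[f finj] QG.
have -> : \bigcup_(D in Q) D =
    \bigcup_k \bigcup_(D in [set D | Q D /\ f D = k]) D.
  apply/seteqP; split => [x [D QD Dx]|x [k _ [D [QD _] Dx]]]; last by exists D.
  by exists (f D) => //; exists D.
apply: sigma_algebra_bigcup => k.
have [[D [QD fD]]|noD] := pselect (exists D, Q D /\ f D = k).
  suff -> : \bigcup_(D in [set D | Q D /\ f D = k]) D = D.
    by apply: sub_gen_smallest; exact: QG.
  apply/seteqP; split => [x [E [QE fE] Ex]|x Dx]; last by exists D.
  by rewrite (finj D E) ?inE ?fD ?fE.
suff -> : \bigcup_(D in [set D | Q D /\ f D = k]) D = set0.
  by case: (@smallest_sigma_algebra X [set: X] G).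
by apply/seteqP; split => // x [D QD _]; apply: noD; exists D.
Qed.

Lemma sigma_cylinder_saturated n A :
  countable P -> saturated n A -> <<s cylinder T P n >> A.
Proof.
move=> cP An; rewrite -(cylinder_hullE An).
apply: sigma_algebra_countable_bigcup => [|D []//].
apply: sub_countable (countable_cylinder n cP).
by apply: subset_card_le => D [].
Qed.

End Itineraries.

(** * Measures of avoidance events under mixing *)

Section MeasurePreserving.
Context {d : measure_display} {X : measurableType d} {R : realType}.
Variables (mu : probability X R) (T : X -> X).
Hypothesis T_mu : measure_preserving mu T.
Implicit Types (A B V : set X).

Local Notation pr A := (fine (mu A)).

Lemma prE A : measurable A -> mu A = (pr A)%:E.
Proof. by move=> mA; rewrite fineK// fin_num_measure. Qed.

Lemma pr_ge0 A : 0 <= pr A.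
Proof. exact: fine_ge0. Qed.

Lemma pr_le A B : measurable A -> measurable B -> A `<=` B -> pr A <= pr B.
Proof.
by move=> mA mB AB; rewrite fine_le ?fin_num_measure// le_measure ?inE.
Qed.

Lemma prT : pr [set: X] = 1.
Proof. by rewrite probability_setT. Qed.

Lemma pr_le1 A : measurable A -> pr A <= 1.
Proof. by move=> mA; rewrite -prT pr_le. Qed.

Lemma pr_split A B : measurable A -> measurable B ->
  pr B = pr (A `&` B) + pr (~` A `&` B).
Proof.
move=> mA mB; have mAB := measurableI _ _ mA mB.
have mAcB := measurableI _ _ (measurableC mA) mB.
have {1}-> : B = (A `&` B) `|` (~` A `&` B) by rewrite -setIUl setUv setTI.
rewrite measureU//; first by rewrite fineD ?fin_num_measure.
by rewrite setIACA setICr set0I.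
Qed.

Lemma pr_setC A : measurable A -> pr (~` A) = 1 - pr A.
Proof.
move=> mA; have := pr_split mA (@measurableT _ X).
by rewrite prT !setIT => ?; lra.
Qed.

Lemma measurable_preimage A : measurable A -> measurable (T @^-1` A).
Proof.
by case: T_mu => mT _ mA; rewrite -[_ @^-1` _]setTI; exact: mT.
Qed.

Lemma measurable_iter n A : measurable A -> measurable (iter n T @^-1` A).
Proof.
elim: n => // n IHn mA.
have -> : iter n.+1 T @^-1` A = T @^-1` (iter n T @^-1` A).
  by apply/seteqP; split => x; rewrite /= -iterSr.
by apply: measurable_preimage; exact: IHn.
Qed.

Lemma pr_preimage A : measurable A -> pr (T @^-1` A) = pr A.
Proof. by case: T_mu => _ h mA; rewrite h. Qed.

Lemma pr_iter n A : measurable A -> pr (iter n T @^-1` A) = pr A.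
Proof.
move=> mA; elim: n => // n IHn; rewrite -[RHS]IHn.
rewrite -[RHS](pr_preimage (measurable_iter n mA)).
by congr (fine (mu _)); apply/seteqP; split => x; rewrite /= -iterSr.
Qed.

Lemma measurable_avoid V t : measurable V -> measurable (avoid T V t).
Proof.
move=> mV; elim: t => [|t IHt]; first by rewrite avoid0.
rewrite avoidS; apply: measurableI; first exact: measurableC.
exact: measurable_preimage.
Qed.

(** Decomposition of a hit according to the last visit to [V] before time [s]:
    by invariance, a last visit that leaves [j] steps without return has the
    measure of the points of [V] that do not return within [j] steps. *)
Lemma pr_hitE V s : measurable V ->
  1 - pr (avoid T V s) = \sum_(j < s) pr (V `&` T @^-1` avoid T V j).
Proof.
move=> mV; elim: s => [|s IHs]; first by rewrite avoid0 prT subrr big_ord0.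
have mA := measurable_avoid s mV.
rewrite big_ord_recr /= -IHs avoidS -[pr (avoid T V s)](pr_preimage mA).
by rewrite (pr_split mV (measurable_preimage mA)); ring.
Qed.

Section Mixing.
Variables (P : set (set X)) (phi : nat -> R).
Hypothesis P_partition : measurable_partition P.
Hypothesis mu_mixing : right_phi_mixing mu T P phi.

Local Notation saturated := (saturated T P).

Lemma mixing_rate_ge0 k : 0 <= phi k.
Proof.
case: mu_mixing => phidec phi0 _.
rewrite -(cvg_lim _ phi0)//; apply: nonincreasing_cvgn_ge => //.
by apply/cvg_ex; exists 0.
Qed.

Lemma pr_mixing n m k A B : measurable A -> measurable B ->
  saturated n A -> saturated m B ->
  `|pr (A `&` iter (n + k) T @^-1` B) - pr A * pr B| <= phi k * pr B.
Proof.
move=> mA mB An Bm; case: mu_mixing => _ _ /(_ n k A B).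
case: P_partition => cP _ partP.
rewrite (prE mA) (prE mB) (prE (measurableI _ _ mA (measurable_iter (n + k) mB))).
rewrite -lee_fin; apply; first exact: sigma_cylinder_saturated.
have: <<s cylinder T P m >> B by exact: sigma_cylinder_saturated.
by apply: sub_smallest2r; [exact: smallest_sigma_algebra|move=> D; exists m].
Qed.

Lemma measurable_saturated n A : saturated n A -> measurable A.
Proof.
case: P_partition => cP mP partP /(sigma_cylinder_saturated partP cP).
apply: smallest_sub; first exact: sigma_algebra_measurable.
move=> D [_ [a [Pa ->]]].
have -> : [set x | forall j, (j < n)%N -> a j (iter j T x)] =
    \bigcap_(j in [set j | (j < n)%N]) (iter j T @^-1` a j) by [].
apply: bigcap_measurableType => j jn.
by apply: measurable_iter; apply: mP; exact: Pa.
Qed.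

Section Escape.
Variables (V : set X) (kappa k : nat).
Hypotheses (mV : measurable V) (Vk : saturated kappa V).

Local Notation v t := (pr (avoid T V t)).

(** Forget the constraint during a gap of length [kappa + k] and apply mixing to
    the two blocks on both sides of it. The error is proportional to the
    measure of the later block, which is what makes it multiplicative. *)
Lemma avoid_le_mul s t : v (s + (kappa + k) + t) <= (v s + phi k) * v t.
Proof.
have mA r := measurable_avoid r mV.
have := pr_mixing k (mA s) (mA t)
  (saturated_avoid (t := s) Vk) (saturated_avoid (t := t) Vk).
rewrite ler_norml => /andP[_]; rewrite lerBlDr -mulrDl [phi k + _]addrC.
apply: le_trans; apply: pr_le => //.
  by apply: measurableI => //; exact: measurable_iter.
by rewrite addnA avoidD; apply: setSI; apply: subset_avoid; lia.
Qed.

(** A point that avoids [V] during the last [t] of [s + t] steps is lost only if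
    it hits [V] during the first [s]. In that event the gap is created by
    dropping the first [kappa + k] of the last [t] steps, so that the loss is
    compared with the measure for the shorter time [t - (kappa + k)]. *)
Lemma avoid_ge_sub s t : (kappa + k <= t)%N ->
  v t - (1 - v s + phi k) * v (t - (kappa + k)) <= v (s + t).
Proof.
move=> gt; have mA r := measurable_avoid r mV.
rewrite -(pr_iter s (mA t)) (pr_split (mA s) (measurable_iter s (mA t))).
rewrite -avoidD lerBlDr lerD2l.
have := pr_mixing k (measurableC (mA s)) (mA (t - (kappa + k))%N)
  (saturatedC (saturated_avoid (t := s) Vk)) (saturated_avoid Vk).
rewrite ler_norml => /andP[_]; rewrite lerBlDr -mulrDl [phi k + _]addrC pr_setC//.
apply: le_trans; apply: pr_le.
- by apply: measurableI; [exact: measurableC|exact: measurable_iter].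
- by apply: measurableI; [exact: measurableC|exact: measurable_iter].
apply: setIS => x /=; rewrite -{1}(subnKC gt) avoidD => -[_] /=.
by rewrite -iterD; have -> : (kappa + k + s = s + kappa + k)%N by lia.
Qed.

(** Iteration of [avoid_le_mul] along consecutive blocks separated by gaps. *)
Lemma avoid_le_expR s t : (0 < s)%N -> (s + (kappa + k) <= t)%N ->
  v t <= expR (- ((1 - v s - phi k) * (t%:R / (s + (kappa + k))%:R - 1))).
Proof.
set L := (s + _)%N; set x := 1 - v s - phi k => s0 Lt.
have L0 : 0 < L%:R :> R by rewrite ltr0n addn_gt0 s0.
have mA r := measurable_avoid r mV.
(* If the mixing error exceeds the hitting probability, the right member is at
   least 1. *)
have [x0|x0] := leP x 0.
  rewrite (le_trans (pr_le1 (mA t)))// -[leLHS]expR0 ler_expR oppr_ge0.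
  by rewrite mulr_le0_ge0// subr_ge0 ler_pdivlMr// mul1r ler_nat.
have vL m : v (m * L) <= expR (- (x * m%:R)).
  elim: m => [|m IHm]; first by rewrite mul0n mulr0 oppr0 expR0 pr_le1.
  rewrite mulSn (le_trans (avoid_le_mul _ _))//.
  have -> : - (x * m.+1%:R) = - x + - (x * m%:R) by rewrite -natr1; ring.
  rewrite expRD ler_pM ?fine_ge0//.
    by rewrite addr_ge0 ?fine_ge0// mixing_rate_ge0.
  by rewrite (le_trans _ (expR_ge1Dx _))// /x; lra.
have tL : (t %/ L * L <= t < (t %/ L).+1 * L)%N.
  by rewrite leq_divM ltn_ceil// addn_gt0 s0.
case/andP: tL => tL Lt'; rewrite (le_trans (pr_le (mA _) (mA _) (subset_avoid tL)))//.
rewrite (le_trans (vL _))// ler_expR lerN2 ler_pM2l// lerBlDr.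
by rewrite ler_pdivrMr// natr1 -natrM ler_nat ltnW.
Qed.

(** As the gap is not longer than a block, [avoid_ge_sub] gives the two-step
    recurrence [v_(i+2) >= v_(i+1) - q * v_i] along multiples of [s], with [q] the
    left member of the last hypothesis. If [v_(i+1) >= (1 - r) * v_i] and
    [q <= r * (1 - r)] then [q * v_i <= r * v_(i+1)], so the ratio of consecutive
    terms never drops below [1 - r]. *)
Lemma avoid_ge_exprn s m r : (kappa + k <= s)%N -> 0 <= r < 1 ->
  1 - v s + phi k <= r * (1 - r) -> (1 - r) ^+ m <= v (m * s).
Proof.
move=> gs /andP[r0 r1] qr; have mA i := measurable_avoid i mV.
have v0 : v 0 = 1 by rewrite avoid0 prT.
have ratio i : (1 - r) * v (i * s) <= v (i.+1 * s).
  elim: i => [|i IHi].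
    rewrite mul0n v0 mul1n mulr1.
    have := mixing_rate_ge0 k.
    have := mulr_ge0 r0 r0; lra.
  have gis : (kappa + k <= i.+1 * s)%N by rewrite mulSn; lia.
  rewrite [in leRHS]mulSn; apply: le_trans (avoid_ge_sub _ gis).
  rewrite mulrBl mul1r lerD2l lerN2.
  apply: (@le_trans _ _ (r * (1 - r) * v (i * s))).
    rewrite ler_pM ?fine_ge0//.
      have := pr_le1 (mA s); have := mixing_rate_ge0 k; lra.
    by apply: pr_le => //; apply: subset_avoid; rewrite mulSn; lia.
  by rewrite -mulrA ler_wpM2l.
elim: m => [|m IHm]; first by rewrite mul0n v0.
rewrite exprS (le_trans _ (ratio m))// ler_wpM2l//; lra.
Qed.

(** Here [r := q / (1 - 2 * q)], which satisfies [q <= r * (1 - r)] as soon as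
    [4 * q <= 1] and is equivalent to [q] for small [q]; moreover
    [r / (1 - r) = q / (1 - 3 * q)]. *)
Lemma avoid_ge_expR s t : (0 < s)%N -> (kappa + k <= s)%N ->
  let q := 1 - v s + phi k in 4 * q <= 1 ->
  expR (- (q / (1 - 3 * q) * (t%:R / s%:R + 1))) <= v t.
Proof.
move=> s0 gs q q4; have mA i := measurable_avoid i mV.
have q0 : 0 <= q.
  by rewrite /q; have := pr_le1 (mA s); have := mixing_rate_ge0 k; lra.
pose r := q / (1 - 2 * q).
have r0 : 0 <= r by rewrite divr_ge0//; lra.
have r1 : 1 - r = (1 - 3 * q) / (1 - 2 * q) by rewrite /r; field; lra.
have r1_gt0 : 0 < 1 - r by rewrite r1 divr_gt0//; lra.
have qr : q <= r * (1 - r).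
  rewrite r1 /r mulf_div ler_pdivlMr; last by rewrite mulr_gt0//; lra.
  by rewrite ler_wpM2l//; nra.
have rE : q / (1 - 3 * q) = r / (1 - r) by rewrite r1 /r; field; lra.
have exp_r : expR (- (r / (1 - r))) <= 1 - r.
  rewrite expRN -[leRHS]invrK lef_pV2 ?posrE ?expR_gt0 ?invr_gt0//.
  apply: le_trans (expR_ge1Dx _); rewrite le_eqVlt; apply/orP; left.
  by apply/eqP; field; lra.
have rr : 0 <= r < 1 by rewrite r0/=; lra.
have s_gt0 : 0 < s%:R :> R by rewrite ltr0n.
have vt : v ((t %/ s).+1 * s) <= v t.
  by apply: pr_le => //; apply: subset_avoid; rewrite ltnW// ltn_ceil.
apply: le_trans vt; apply: le_trans (avoid_ge_exprn _ gs rr qr).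
rewrite rE; apply: (@le_trans _ _ (expR (- (r / (1 - r))) ^+ (t %/ s).+1)); last first.
  by apply: lerXn2r => //; rewrite ?nnegrE ?expR_ge0//; exact: ltW.
rewrite -expRM_natl ler_expR mulrN lerN2 mulrC ler_wpM2l//.
  exact: divr_ge0 r0 (ltW r1_gt0).
by rewrite -natr1 lerD2r ler_pdivlMr// -natrM ler_nat leq_divM.
Qed.

Lemma decay_rateE t :
  decay_rate mu T V t = ((t%:R^-1)%:E * `|lne (v t)%:E|)%E.
Proof.
have mA := measurable_avoid t mV.
rewrite /decay_rate entry_time_gtE prE; last exact: measurable_preimage.
by rewrite pr_preimage.
Qed.

Lemma lower_escape_rate_ge s : (0 < s)%N ->
  (((1 - v s - phi k) / (s + (kappa + k))%:R)%:E <= lower_escape_rate mu T V)%E.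
Proof.
set x := 1 - _ - _ => s0; set L := (s + _)%N.
have L0 : (0 < L)%N by rewrite addn_gt0 s0.
apply: (@limn_einf_ge _ _ (fun t => x / L%:R - x / t%:R)).
  near=> t; have Lt : (L <= t)%N by near: t; exact: nbhs_infty_ge.
  have t0 : 0 < t%:R :> R by rewrite ltr0n (leq_trans L0).
  rewrite decay_rateE.
  have -> : x / L%:R - x / t%:R = t%:R^-1 * (x * (t%:R / L%:R - 1)).
    by field; rewrite !gt_eqF// ltr0n.
  rewrite EFinM lee_pmul2l ?lte_fin ?invr_gt0//.
  by apply: abs_lne_ge; [exact: fine_ge0|exact: avoid_le_expR].
rewrite -[X in _ --> X]subr0 -[X in _ - X](mulr0 x).
apply: cvgB; first exact: cvg_cst.
by apply: cvgMr; exact: cvg_invn.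
Unshelve. all: by end_near. Qed.

Lemma upper_escape_rate_le s : (0 < s)%N -> (kappa + k <= s)%N ->
  let q := 1 - v s + phi k in 4 * q <= 1 ->
  (upper_escape_rate mu T V <= (q / (1 - 3 * q) / s%:R)%:E)%E.
Proof.
move=> s0 gs q q4; set c := q / _.
apply: (@limn_esup_le _ _ (fun t => c / s%:R + c / t%:R)).
  near=> t; have t0 : (0 < t)%N by near: t; exact: nbhs_infty_gt.
  rewrite decay_rateE.
  have -> : c / s%:R + c / t%:R = t%:R^-1 * (c * (t%:R / s%:R + 1)).
    by field; rewrite !gt_eqF// ltr0n.
  rewrite EFinM lee_pmul2l ?lte_fin ?invr_gt0 ?ltr0n//.
  apply: abs_lne_le; first by apply: pr_le1; exact: measurable_avoid.
  exact: avoid_ge_expR.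
rewrite -[X in _ --> X]addr0 -[X in _ + X](mulr0 c).
apply: cvgD; first exact: cvg_cst.
by apply: cvgMr; exact: cvg_invn.
Unshelve. all: by end_near. Qed.

End Escape.

(** * Short returns *)

Section Returns.
Variables (V : set X) (kappa : nat).
Hypotheses (mV : measurable V) (Vk : saturated kappa V).

(** Cut the return time [i] at its half. If the half is shorter than [kappa], the
    set [V] is enlarged to its hull of order [i./2], so that the remaining half
    is a gap to which mixing applies; otherwise [V] itself is known after
    [kappa] steps, and the gap [i - kappa] is at least [i./2]. *)
Lemma pr_return_le (c : nat -> R) i :
  (forall j, (0 < j)%N -> 0 <= c j) ->
  (forall j, (0 < j < kappa)%N -> pr (cylinder_hull T P j V) <= pr V + c j) ->
  (1 < i)%N ->
  pr (V `&` iter i T @^-1` V) <= (pr V + c i./2 + phi i./2) * pr V.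
Proof.
move=> c0 hull i1; have [_ _ partP] := P_partition.
have phidec : nonincreasing_seq phi by case: mu_mixing.
have i20 : (0 < i./2)%N by rewrite half_gt0.
have i2 := odd_double_half i.
suff [n [A [ni An VA Ac]]] : exists n A, [/\ (i./2 <= i - n)%N && (n <= i)%N,
    saturated n A, V `<=` A & pr A <= pr V + c i./2].
  case/andP: ni => ni /subnKC ni'.
  have mA := measurable_saturated An.
  have := pr_mixing (i - n) mA mV An Vk.
  rewrite ni' ler_norml => /andP[_]; rewrite lerBlDr -mulrDl => AV.
  apply: (@le_trans _ _ (pr (A `&` iter i T @^-1` V))).
    by apply: (pr_le _ _ (setSI VA)); apply: measurableI => //; exact: measurable_iter.
  apply: le_trans AV _; rewrite addrC ler_wpM2r ?pr_ge0// lerD//.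
  exact: phidec.
have [ik|ki] := ltnP i./2 kappa.
  exists i./2, (cylinder_hull T P i./2 V); split.
  - lia.
  - by apply: saturated_bigcup_cylinder => // D [].
  - exact: subset_cylinder_hull.
  - by apply: hull; rewrite i20.
exists kappa, V; split => //; first lia.
by rewrite lerDl c0.
Qed.

Lemma pr_no_return_ge K s : (K <= s)%N ->
  pr (V `&` T @^-1` avoid T V K)
    - \sum_(K <= j < s) pr (V `&` iter j.+1 T @^-1` V)
  <= pr (V `&` T @^-1` avoid T V s).
Proof.
have mA j := measurable_avoid j mV; have mTA j := measurable_preimage (mA j).
elim: s => [|s IHs]; first by rewrite leqn0 => /eqP->; rewrite big_geq// subr0.
rewrite leq_eqVlt => /orP[/eqP->|]; first by rewrite big_geq// subr0.
rewrite ltnS => Ks; rewrite big_nat_recr//= opprD addrA.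
have mVs : measurable (iter s.+1 T @^-1` V) by exact: measurable_iter.
have := pr_split mVs (measurableI _ _ mV (mTA s)).
have -> : ~` (iter s.+1 T @^-1` V) `&` (V `&` T @^-1` avoid T V s) =
          V `&` T @^-1` avoid T V s.+1.
  rewrite setICA -[in RHS]addn1 avoidD avoid1; congr (_ `&` _).
  rewrite setIC preimage_setI; congr (_ `&` _).
  by apply/seteqP; split => x; rewrite /= -iterSr.
have : pr (iter s.+1 T @^-1` V `&` (V `&` T @^-1` avoid T V s)) <=
       pr (V `&` iter s.+1 T @^-1` V).
  apply: pr_le; last by move=> x [? []].
    exact: measurableI mVs (measurableI _ _ mV (mTA s)).
  exact: measurableI.
have := IHs Ks; lra.
Qed.

End Returns.
End Mixing.
End MeasurePreserving.

(** * The limit of the hitting rates and the localized escape rate *)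

Section ConditionalReturns.
Context {d : measure_display} {X : measurableType d} {R : realType}.
Variables (mu : probability X R) (T : X -> X).
Hypothesis T_mu : measure_preserving mu T.

Local Notation pr A := (fine (mu A)).
Local Notation survival V j :=
  (cond_prob mu V [set x | time_gt (entry_time T V x) j]).

Lemma survivalE V j :
  survival V j = pr (V `&` T @^-1` avoid T V j) / pr V.
Proof. by rewrite /cond_prob entry_time_gtE setIC. Qed.

(** Returns later than [K] are unlikely: the bound of [pr_return_le], summed over
    the times from [K + 1] to [s], splits into a term growing like [s * mu (U n)]
    and two tails of convergent series, which depend on [K] only. *)
Lemma survival_ge0 V j : 0 <= survival V j.
Proof. by rewrite divr_ge0 ?fine_ge0. Qed.

Lemma survival_le1 V j : measurable V -> survival V j <= 1.
Proof.
move=> mV; rewrite survivalE; have [->|V0] := eqVneq (pr V) 0.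
  by rewrite invr0 mulr0 ler01.
rewrite ler_pdivrMr ?mul1r ?lt_neqAle ?(eq_sym 0) ?V0 ?fine_ge0//.
apply: pr_le => //; apply: measurableI => //.
by apply: (measurable_preimage T_mu); exact: (measurable_avoid T_mu).
Qed.

Lemma survival_nonincreasing V : measurable V ->
  {homo (fun j => survival V j) : i j / (i <= j)%N >-> j <= i}.
Proof.
move=> mV i j ij; rewrite !survivalE ler_wpM2r ?invr_ge0 ?fine_ge0//.
have mA l : measurable (V `&` T @^-1` avoid T V l).
  apply: measurableI => //.
  by apply: (measurable_preimage T_mu); exact: (measurable_avoid T_mu).
by apply: pr_le => //; apply: setIS => x; exact: (subset_avoid ij).
Qed.

(** For order 2 the numbers [hat_alpha] only see the first return, which makes
    [alpha1] the complement to 1 of [hat_alpha U 2]. *)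
Lemma hat_alpha_set2E V K : measurable V -> 0 < pr V ->
  hat_alpha_set mu T 2 K V = 1 - survival V K.
Proof.
move=> mV V0; set gtK := [set x | time_gt (entry_time T V x) K].
have mK : measurable gtK.
  rewrite /gtK entry_time_gtE.
  by apply: (measurable_preimage T_mu); exact: (measurable_avoid T_mu).
have le2E : [set x | time_le (entry_time_iter T V 2.-1 x) K] = ~` gtK.
  apply/seteqP; split => x /=; rewrite /gtK /time_gt /=.
    by case: entry_time => [t|] //= ->.
  by move/negP; rewrite negbK; case: entry_time.
rewrite /hat_alpha_set /cond_prob le2E -[1](@divff _ (pr V)) ?gt_eqF//.
by rewrite -mulrBl; congr (_ / _); have := pr_split mu mK mV; lra.
Qed.

(** The inner limits exist by assumption from [K0] on; they are nonincreasing in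
    [K] and nonnegative, so they converge. *)
Lemma ex_is_alpha1 (U : nat -> set X) :
  (forall n, measurable (U n)) -> (forall n, 0 < pr (U n)) ->
  hat_alpha_exists mu T U -> exists a, is_alpha1 mu T U a.
Proof.
move=> mU U0 [K0 alphaU].
pose aK K := limn (fun n => survival (U n) K).
have cvgK K : (K0 <= K)%N -> survival (U n) K @[n --> \oo] --> aK K.
  move=> K0K; suff : cvgn (fun n => survival (U n) K) by [].
  have := @alphaU K 2%N K0K isT.
  have -> : (fun n => hat_alpha_set mu T 2 K (U n)) =
            (fun n => 1 - survival (U n) K).
    by apply/funext => n; exact: hat_alpha_set2E.
  move=> cv; have -> : (fun n => survival (U n) K) =
            (fun n => 1 - (1 - survival (U n) K)).
    by apply/funext => n; rewrite opprB addrC subrK.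
  by apply: is_cvgB => //; exact: is_cvg_cst.
have decK K L : (K0 <= K)%N -> (K <= L)%N -> aK L <= aK K.
  move=> K0K KL; apply: ler_lim.
  - by apply/cvg_ex; exists (aK L); apply: cvgK; exact: leq_trans KL.
  - by apply/cvg_ex; exists (aK K); exact: cvgK.
  - by near=> n; exact: survival_nonincreasing.
have cvga : cvgn (fun K => aK (K + K0)%N).
  apply: nonincreasing_is_cvgn.
    by move=> K L KL; apply: decK; rewrite ?leq_addl// leq_add2r.
  exists 0 => _ [K _ <-]; apply: limr_ge.
    by apply/cvg_ex; exists (aK (K + K0)%N); apply: cvgK; rewrite leq_addl.
  by near=> n; exact: survival_ge0.
exists (limn (fun K => aK (K + K0)%N)), aK; split.
  by near=> K; apply: cvgK; near: K; exact: nbhs_infty_ge.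
by rewrite -(cvg_shiftn K0).
Unshelve. all: by end_near. Qed.

Section GoodNeighborhoods.
Variables (P : set (set X)) (phi : nat -> R) (U : nat -> set X).
Variables (kappa : nat -> nat) (C p C' p' a : R).
Hypotheses (P_partition : measurable_partition P)
  (mu_mixing : right_phi_mixing mu T P phi)
  (C_gt0 : 0 < C) (p_gt1 : 1 < p)
  (phi_le : forall k : nat, (0 < k)%N -> phi k <= C * k%:R `^ (- p))
  (mU : forall n, measurable (U n)) (U_gt0 : forall n, 0 < pr (U n))
  (Uk : forall n, saturated T P (kappa n) (U n))
  (C'_gt0 : 0 < C') (p'_gt1 : 1 < p')
  (hull_le : forall n j, (0 < j < kappa n)%N ->
    pr (cylinder_hull T P j (U n)) <= pr (U n) + C' * j%:R `^ (- p'))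
  (alpha1 : is_alpha1 mu T U a).

Local Notation m n := (pr (U n)).
Local Notation hit n s := (1 - pr (avoid T (U n) s)).

Lemma survival_ge n K s : (0 < K)%N -> (K <= s)%N ->
  survival (U n) K - s%:R * m n
    - (C' * (4 `^ p' * (K%:R `^ (1 - p') / (p' - 1)))
       + C * (4 `^ p * (K%:R `^ (1 - p) / (p - 1))))
  <= survival (U n) s.
Proof.
move=> K0 Ks; have Un0 := U_gt0 n.
set c := C' * _ + _.
have return_le j : (K <= j)%N ->
    pr (U n `&` iter j.+1 T @^-1` U n) <=
    (m n + (C' * (j.+1./2)%:R `^ (- p') + C * (j.+1./2)%:R `^ (- p))) * m n.
  move=> Kj; have j1 : (1 < j.+1)%N by rewrite ltnS (leq_trans K0).
  have c0 i : (0 < i)%N -> 0 <= C' * i%:R `^ (- p').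
    by move=> _; rewrite mulr_ge0 ?powR_ge0// ltW.
  have := pr_return_le T_mu P_partition mu_mixing (mU n) (@Uk n) c0 (@hull_le n) j1.
  move=> /le_trans; apply.
  by rewrite ler_pM2r// addrA lerD2l phi_le// half_gt0.
have sum_le : \sum_(K <= j < s) pr (U n `&` iter j.+1 T @^-1` U n) <=
    (s%:R * m n + c) * m n.
  apply: (@le_trans _ _ (\sum_(K <= j < s) ((m n + (C' * (j.+1./2)%:R `^ (- p')
      + C * (j.+1./2)%:R `^ (- p))) * m n))).
    by apply: ler_sum_nat => j /andP[Kj _]; exact: return_le.
  rewrite -mulr_suml ler_pM2r// !big_split/= -!mulr_sumr sumr_const_nat.
  rewrite lerD//; first by rewrite -[leLHS]mulr_natl ler_pM2r// ler_nat leq_subr.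
  by apply: lerD; (apply: ler_wpM2l; [exact: ltW|exact: sum_half_powRN_le]).
rewrite !survivalE ler_pdivlMr// !mulrBl divfK ?gt_eqF//.
have := pr_no_return_ge T_mu (mU n) Ks; lra.
Qed.

(** By [pr_hitE] the ratio is the average over [j < s n] of the probabilities of
    no return within [j] steps, given a start in [U n]; these are nearly constant
    for [j] between a large [K] and [s n]. *)
Lemma cvg_hit (s : nat -> nat) : s n @[n --> \oo] --> \oo ->
  (s n)%:R * m n @[n --> \oo] --> (0 : R) ->
  hit n (s n) / ((s n)%:R * m n) @[n --> \oo] --> a.
Proof.
move=> sy sm0; have [aK [survK aKa]] := alpha1.
pose e (K : nat) := C' * (4 `^ p' * (K%:R `^ (1 - p') / (p' - 1)))
                + C * (4 `^ p * (K%:R `^ (1 - p) / (p - 1))).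
have e0 : e K @[K --> \oo] --> 0.
  rewrite -[0 in X in _ --> X]addr0; apply: cvgD.
    rewrite -[0](mulr0 C'); apply: cvgMr.
    rewrite -[0](mulr0 (4 `^ p')); apply: cvgMr.
    by rewrite -[0](mul0r (p' - 1)^-1); apply: cvgMl; exact: cvg_powRN_natr.
  rewrite -[0](mulr0 C); apply: cvgMr.
  rewrite -[0](mulr0 (4 `^ p)); apply: cvgMr.
  by rewrite -[0](mul0r (p - 1)^-1); apply: cvgMl; exact: cvg_powRN_natr.
have -> : (fun n => hit n (s n) / ((s n)%:R * m n)) =
    (fun n => (s n)%:R^-1 * \sum_(j < s n) survival (U n) j).
  apply/funext => n; rewrite (pr_hitE T_mu _ (mU n)) mulr_suml mulr_sumr.
  by apply: eq_bigr => j _; rewrite survivalE invfM mulrCA.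
apply: (@cvg_cesaro_diagonal _ (fun n j => survival (U n) j) s
  (fun n => (s n)%:R * m n) e aK a) => //.
- by move=> n; apply: survival_nonincreasing; exact: mU.
- by move=> n j; rewrite survival_ge0 survival_le1//; exact: mU.
- near=> K; near=> n; apply: survival_ge.
    by near: K; exact: nbhs_infty_gt.
  by near: n; move/cvgnyPge: sy; apply.
Unshelve. all: by end_near. Qed.

Hypotheses (kappa_oo : kappa n @[n --> \oo] --> \oo)
  (kappa_m0 : (kappa n)%:R * m n @[n --> \oo] --> (0 : R)).

(** The gap between blocks has length [kappa n + kappa n]: the letters that
    describe [U n], followed by [kappa n] steps for the mixing to act. The last two
    limits say that gaps and mixing errors are negligible. *)
Lemma ex_block_lengths : exists s : nat -> nat,
  [/\ s n @[n --> \oo] --> \oo,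
      (s n)%:R * m n @[n --> \oo] --> (0 : R),
      (kappa n)%:R / (s n)%:R @[n --> \oo] --> (0 : R) &
      phi (kappa n) / ((s n)%:R * m n) @[n --> \oo] --> (0 : R)].
Proof.
have phi_ge0 k : 0 <= phi k := mixing_rate_ge0 mu_mixing k.
have phi0 : phi k @[k --> \oo] --> 0 by case: mu_mixing.
pose delta n := Num.sqrt ((kappa n)%:R * m n + phi (kappa n)).
have delta0 : delta n @[n --> \oo] --> 0.
  have sum0 : (kappa n)%:R * m n + phi (kappa n) @[n --> \oo] --> (0 : R).
    rewrite -[X in _ --> X]addr0; apply: cvgD => //.
    exact: (cvg_comp _ _ kappa_oo phi0).
  rewrite -sqrtr0; apply: (cvg_comp _ _ sum0); exact: sqrt_continuous.
have /choice[s sP] : forall n, exists s : nat,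
    (0 < kappa n)%N -> delta n <= 4^-1 ->
    [/\ s%:R * m n <= delta n, (kappa n)%:R <= 2 * delta n * s%:R &
        phi (kappa n) <= 2 * delta n * (s%:R * m n)].
  move=> n; have [k0|] := posnP (kappa n); first by exists 0%N; rewrite k0.
  move=> k0; have [d4|d4] := leP (delta n) 4^-1; last first.
    by exists 0%N.
  by have [s sP] := block_length_exists (U_gt0 n) (phi_ge0 _) k0 d4; exists s.
have s_near : \forall n \near \oo,
    [/\ (0 < kappa n)%N, (kappa n <= s n)%N, (s n)%:R * m n <= delta n,
        (kappa n)%:R / (s n)%:R <= 2 * delta n &
        phi (kappa n) / ((s n)%:R * m n) <= 2 * delta n].
  near=> n.
  have k0 : (0 < kappa n)%N by near: n; move/cvgnyPge: kappa_oo => /(_ 1%N).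
  have d4 : delta n <= 4^-1.
    near: n; apply: (cvgr_le _ delta0).
    by rewrite invr_gt0.
  have [sm ks fs] := sP n k0 d4.
  have k0' : 0 < (kappa n)%:R :> R by rewrite ltr0n.
  have d0 : 0 <= delta n by exact: sqrtr_ge0.
  have ks' : (kappa n <= s n)%N.
    rewrite -(ler_nat R) (le_trans ks)// ler_piMl//; lra.
  have s0 : 0 < (s n)%:R :> R by rewrite ltr0n (leq_trans k0).
  split => //; first by rewrite ler_pdivrMr.
  by rewrite ler_pdivrMr// mulr_gt0.
have d20 : 2 * delta n @[n --> \oo] --> 0.
  by rewrite -[0](mulr0 2); apply: cvgMr.
exists s; split.
- apply/cvgnyPge => A; move/cvgnyPge : kappa_oo => /(_ A).
  by apply: filterS2 s_near => n [_ ks _ _ _] Ak; exact: leq_trans ks.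
- apply: (squeeze_cvgr _ (cvg_cst 0) delta0).
  by apply: filterS s_near => n [_ _ sm _ _]; rewrite mulr_ge0//= ltW.
- apply: (squeeze_cvgr _ (cvg_cst 0) d20).
  by apply: filterS s_near => n [_ _ _ ks _]; rewrite divr_ge0/=.
- apply: (squeeze_cvgr _ (cvg_cst 0) d20).
  apply: filterS s_near => n [_ _ _ _ fs].
  by rewrite fs andbT divr_ge0// mulr_ge0// ltW.
Unshelve. all: by end_near. Qed.

(** In terms of [w := hit / z], where [z := s * mu (U n)], of the ratio [om] of
    [kappa] to [s] and of the relative mixing error [rho], the bounds of
    [lower_escape_rate_ge] and [upper_escape_rate_le] are [lo] and [up] below, and
    both tend to [a]. *)
Lemma escape_rate_quotients :
  ((lower_escape_rate mu T (U n) / mu (U n))%E @[n --> \oo] --> a%:E) /\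
  ((upper_escape_rate mu T (U n) / mu (U n))%E @[n --> \oo] --> a%:E).
Proof.
have [s [s_oo sm0 ks0 fs0]] := ex_block_lengths.
pose z n := (s n)%:R * m n.
pose w n := hit n (s n) / z n.
pose om n : R := (kappa n)%:R / (s n)%:R.
pose rho n := phi (kappa n) / z n.
pose lo n := (w n - rho n) / (1 + 2 * om n).
pose up n := (w n + rho n) / (1 - 3 * ((w n + rho n) * z n)).
have wa : w n @[n --> \oo] --> a := cvg_hit s_oo sm0.
have q0 : (w n + rho n) * z n @[n --> \oo] --> 0.
  rewrite -(mulr0 (a + 0)); apply: cvgM => //; exact: cvgD.
have lo_a : lo n @[n --> \oo] --> a.
  rewrite -[a]divr1 -[a in a / _]subr0; apply: cvgM; first exact: cvgB.
  apply: cvgV => //; rewrite -[X in _ --> X]addr0; apply: cvgD; first exact: cvg_cst.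
  by rewrite -[0](mulr0 2); apply: cvgMr.
have up_a : up n @[n --> \oo] --> a.
  rewrite -[a]divr1 -[a in a / _]addr0; apply: cvgM; first exact: cvgD.
  apply: cvgV => //; rewrite -[X in _ --> X]subr0; apply: cvgB; first exact: cvg_cst.
  by rewrite -[0](mulr0 3); apply: cvgMr.
have bounds : \forall n \near \oo,
    ((lo n)%:E <= lower_escape_rate mu T (U n) / mu (U n))%E /\
    (upper_escape_rate mu T (U n) / mu (U n) <= (up n)%:E)%E.
  near=> n.
  have m0 := U_gt0 n.
  have s0 : (0 < s n)%N by near: n; move/cvgnyPge: s_oo => /(_ 1%N).
  have s0' : 0 < (s n)%:R :> R by rewrite ltr0n.
  have gs : (kappa n + kappa n <= s n)%N.
    have : om n <= 2^-1 by near: n; apply: (cvgr_le _ ks0); rewrite invr_gt0.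
    rewrite ler_pdivrMr// -(ler_nat R) natrD; lra.
  have zn0 : 0 < z n by rewrite mulr_gt0.
  have qE : (w n + rho n) * z n = hit n (s n) + phi (kappa n).
    by rewrite mulrDl !divfK ?gt_eqF.
  have q4 : 4 * (hit n (s n) + phi (kappa n)) <= 1.
    have : (w n + rho n) * z n <= 4^-1.
      by near: n; apply: (cvgr_le _ q0); rewrite invr_gt0.
    rewrite qE; lra.
  have -> : lo n = (hit n (s n) - phi (kappa n)) /
                   (s n + (kappa n + kappa n))%:R * (m n)^-1.
    rewrite /lo /w /rho /om /z !natrD; field.
    by rewrite !gt_eqF//; have : 0 <= (kappa n)%:R :> R by []; lra.
  have -> : up n = (hit n (s n) + phi (kappa n)) /
      (1 - 3 * (hit n (s n) + phi (kappa n))) / (s n)%:R * (m n)^-1.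
    rewrite /up qE -[w n + rho n](mulfK (lt0r_neq0 zn0)) qE /z; field.
    by rewrite !gt_eqF//; lra.
  rewrite (prE mu (mU n)) inver gt_eqF//.
  split; rewrite EFinM; apply: lee_wpmul2r; rewrite ?lee_fin ?invr_ge0 ?(ltW m0)//.
    exact: (lower_escape_rate_ge T_mu P_partition mu_mixing (kappa n) (mU n) (@Uk n)).
  exact: (upper_escape_rate_le T_mu P_partition mu_mixing (mU n) (@Uk n)).
have lu n : (lower_escape_rate mu T (U n) / mu (U n) <=
             upper_escape_rate mu T (U n) / mu (U n))%E.
  apply: lee_wpmul2r; last exact: limn_einf_sup.
  by rewrite inve_ge0.
have loE : (lo n)%:E @[n --> \oo] --> a%:E by apply: cvg_EFin => //; near=> n.
have upE : (up n)%:E @[n --> \oo] --> a%:E by apply: cvg_EFin => //; near=> n.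
split; apply: (squeeze_cvge _ loE upE); apply: filterS bounds => n [l u].
  by rewrite l (le_trans (lu n)).
by rewrite u andbT (le_trans _ (lu n)).
Unshelve. all: by end_near. Qed.

Lemma localized_escape_rate : is_localized_escape_rate mu T U a%:E.
Proof.
have [lower_a upper_a] := escape_rate_quotients.
split => // r rP; apply: cvg_trans lower_a; apply: near_eq_cvg.
apply: filterS rP => n /cvg_limn_einf_sup[<- _] //.
Qed.

End GoodNeighborhoods.
End ConditionalReturns.

Theorem theorem1 (R : realType) (M : pmetricType R)
  (compactM : compact [set: M])
  (mu : probability (borel M) R) (T : borel M -> borel M)
  (P : set (set (borel M))) (phi : nat -> R) (C p : R)
  (U : nat -> set (borel M))
  (T_mu : measure_preserving mu T)
  (P_partition : measurable_partition P)
  (P_generating : generating T P)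
  (mu_mixing : right_phi_mixing mu T P phi)
  (C_gt0 : 0 < C) (p_gt1 : 1 < p)
  (phi_le : forall k : nat, (0 < k)%N -> phi k <= C * k%:R `^ (- p))
  (U_good : good_neighborhood_system mu T P U)
  (alpha_exists : hat_alpha_exists mu T U)
  (alpha_summable : cvgn (series (fun l : nat => l%:R * hat_alpha mu T U l))) :
  exists alpha1 : R,
    is_alpha1 mu T U alpha1 /\ is_localized_escape_rate mu T U alpha1%:E.
Proof.
case: U_good => -[mU U_gt0 _ _] [kappa [_ U_cyl kappa_oo]].
move=> [eps [/andP[eps0 eps1] kappa_eps]] [C' [p' [C'0 p'1 hull_le]]].
have Uk n : saturated T P (kappa n) (U n).
  by have [F Fcyl ->] := U_cyl n; exact: saturated_bigcup_cylinder.
have m_gt0 n : 0 < fine (mu (U n)).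
  by rewrite -lte_fin -prE.
have kappa_m0 : (kappa n)%:R * fine (mu (U n)) @[n --> \oo] --> (0 : R).
  apply: (squeeze_cvgr _ (cvg_cst 0) kappa_eps); apply: nearW => n.
  rewrite mulr_ge0 ?fine_ge0//= ler_wpM2l// ger1_powR ?m_gt0 ?pr_le1// ltW//.
have hull_le' n j : (0 < j < kappa n)%N ->
    fine (mu (cylinder_hull T P j (U n)))
      <= fine (mu (U n)) + C' * j%:R `^ (- p').
  move=> /hull_le; rewrite -lee_fin EFinD -!prE//.
  apply: (measurable_saturated T_mu P_partition (n := j)).
  by case: P_partition => _ _ ?; apply: saturated_bigcup_cylinder => // D [].
have [a aP] := ex_is_alpha1 T_mu mU m_gt0 alpha_exists.
exists a; split => //.
exact: (localized_escape_rate T_mu P_partition mu_mixing C_gt0 p_gt1 phi_le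
          mU m_gt0 Uk C'0 p'1 hull_le').
Qed.
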